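(* For every positive integer $m$ and every $\varepsilon\in(0,1)$ there exist constants $\delta=\delta(\varepsilon,m)>0$ and $C=C(\varepsilon,m)>0$ such that the following holds. Let $H$ be an undirected graph with $m$ edges, and let $A$ be a graph of density $\alpha>0$ on a finite vertex set $\mathcal X$. If $$\left|t_H(A)-\alpha^m\right|\ge \varepsilon\alpha^m,$$ then at least one of the following holds: (1) $A$ has at least $2^{-C\log(2/\alpha)}|\mathcal X|$ vertices with degrees at most $(1-\delta)\alpha|\mathcal X|$; or (2) there exist $S,T\subseteq\mathcal X$ with $\frac{|S|}{|\mathcal X|},\frac{|T|}{|\mathcal X|}\ge 2^{-C\log^2(2/\alpha)}$ satisfying $$\mathbb E_{(\mathbf x,\mathbf y)\in S\times T}[A(\mathbf x,\mathbf y)]\ge (1+\delta)\alpha .$$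
   Context: A graph on a finite vertex set $\mathcal X$ is identified with a symmetric function $A:\mathcal X\times\mathcal X\to\{0,1\}$ (the indicator function of its edges). Its density is $\mathbb E[A]=\mathbb E_{\mathbf x_1,\mathbf x_2\in\mathcal X}[A(\mathbf x_1,\mathbf x_2)]$, where $\mathbf x_1,\mathbf x_2$ are uniform and independent in $\mathcal X$. The degree of $x\in\mathcal X$ is $|\{y\in\mathcal X: A(x,y)=1\}|$. For an undirected simple graph $H=([k],E_H)$, where $[k]=\{1,\dots,k\}$, define $$t_H(A)=\mathbb E_{\mathbf x_1,\dots,\mathbf x_k\in\mathcal X}\Big[\prod_{\{i,j\}\in E_H}A(\mathbf x_i,\mathbf x_j)\Big],$$ with $\mathbf x_1,\dots,\mathbf x_k$ uniform and independent in $\mathcal X$. $\log$ is the base-2 logarithm, and $\log^2(t)=(\log t)^2$. Expectations over $(\mathbf x,\mathbf y)\in S\times T$ are uniform. *)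

(* Defs.v *)
From mathcomp Require Import all_boot all_order all_algebra.
From mathcomp Require Import all_classical all_reals all_analysis.

Set Implicit Arguments.
Unset Strict Implicit.
Unset Printing Implicit Defensive.

Import Order.TTheory GRing.Theory Num.Theory.
Local Open Scope ring_scope.

Definition log2 (R : realType) (t : R) : R := ln t / ln 2.

(* Expectation of f at a uniform random element of D (0 when D is empty). *)
Definition expect (R : realType) (T : finType) (D : {set T}) (f : T -> R) : R :=
  (\sum_(x in D) f x) / #|D|%:R.

(* A graph is given by its {0,1}-valued indicator, a [rel X]; booleans are
   coerced to 0 and 1. Symmetry is assumed where graphs are quantified. *)

Definition density_on (R : realType) (X : finType) (A : rel X)
    (S T : {set X}) : R :=
  expect (finset.setX S T) (fun p => (A p.1 p.2)%:R).

Definition density (R : realType) (X : finType) (A : rel X) : R :=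
  density_on R A [set: X]%SET [set: X]%SET.

Definition degree (X : finType) (A : rel X) (x : X) : nat :=
  #|[set y | A x y]%SET|.

(* For a symmetric irreflexive H, each unordered edge {i, j} is represented
   exactly once, by the ordered pair with i < j. *)
Definition edges (k : nat) (H : rel 'I_k) : {set 'I_k * 'I_k} :=
  [set p : 'I_k * 'I_k | (p.1 < p.2)%N && H p.1 p.2]%SET.

(* A uniform function 'I_k -> X amounts to k independent uniform vertices. *)
Definition hom_density (R : realType) (k : nat) (H : rel 'I_k)
    (X : finType) (A : rel X) : R :=
  expect [set: {ffun 'I_k -> X}]%SET
    (fun x => \prod_(p in edges H) (A (x p.1) (x p.2))%:R).

(* Main.v *)
(** Suppose neither (1) nor (2) holds; write u = alpha / 2.

    A set T is regular when all but a polynomially small (in u) fraction of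
    the vertices have about alpha |T| neighbours in T.  The whole vertex set
    is regular: low degrees are excluded by the failure of (1), high ones by
    the failure of (2).  If a large T is regular, then so is T :&: N(x) for
    almost every x.  Otherwise the correlations
      B(x, x') = \sum_(y in T) (A x y - alpha) (A x' y - alpha)
    are often large in absolute value.  As B is a Gram matrix, its entrywise
    powers are positive semidefinite, so its odd moments are nonnegative and B
    is often large and positive; hence a moment of order p = O(log (2 / alpha))
    of the codegrees in T is exponentially larger than expected.  Following
    Kelley and Meka, some common neighbourhood S of p vertices of T then has a
    larger average codegree in T than alpha^2 |T|, so that many vertices of T
    have more than (1 + delta) alpha |S| neighbours in S, contradicting the
    failure of (2).

    Iterating, almost all d-tuples of vertices have about alpha^d |X| common
    neighbours.  Counting homomorphisms by embedding one vertex of H last, the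
    removal of a vertex of degree d changes the count by a factor about
    alpha^d, and induction on H concludes. *)

Require Import Defs.
From mathcomp Require Import all_boot all_order all_algebra.
From mathcomp Require Import all_classical all_reals all_analysis.
From mathcomp Require Import ring lra zify.
Import Order.TTheory GRing.Theory Num.Theory.
Local Open Scope ring_scope.

Set Implicit Arguments.
Unset Strict Implicit.
Unset Printing Implicit Defensive.

(** * Moment inequalities *)

Lemma bernoulli_ineq (R : realFieldType) (y : R) (n : nat) :
  -1 <= y -> 1 + n%:R * y <= (1 + y) ^+ n.
Proof.
move=> y1; elim: n => [|n IHn]; first by rewrite mul0r addr0 expr0.
rewrite exprS -natr1.
have hn : 0 <= (n%:R : R) by [].
have hy : 0 <= y ^+ 2 by apply: sqr_ge0.
have := ler_wpM2l (_ : 0 <= 1 + y) IHn.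
have h0 : 0 <= 1 + y by lra.
move=> /(_ h0); apply: le_trans.
have := mulr_ge0 hn hy; nra.
Qed.

(** This is Bernoulli's inequality at [(x - b) / (r.+1%:R * b)]: the left side is the tangent at
    [x = b] to the convex right side, and this tangent passes through the origin. *)
Lemma power_above_tangent (R : realFieldType) (r : nat) (b x : R) :
  0 < b -> 0 <= x ->
  (r.+1%:R * b) ^+ r.+1 * x <= b * (r%:R * b + x) ^+ r.+1.
Proof.
move=> b0 x0.
have r0 : 0 < (r.+1%:R : R) by rewrite ltr0n.
have c0 : 0 < r.+1%:R * b by rewrite mulr_gt0.
pose y := (x - b) / (r.+1%:R * b).
have y1 : -1 <= y.
  rewrite /y ler_pdivlMr //.
  have : b <= r.+1%:R * b by rewrite ler_peMl ?(ltW b0) // ler1n.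
  lra.
have Er : r%:R = r.+1%:R - 1 :> R by rewrite -natr1 addrK.
have E : r%:R * b + x = (r.+1%:R * b) * (1 + y).
  rewrite /y Er; move: (gt_eqF r0) (gt_eqF b0) => /negbT rn /negbT bn.
  by move: (r.+1%:R) rn => c rn; field; rewrite rn bn.
have Ex : x = b * (1 + r.+1%:R * y).
  rewrite /y; move: (gt_eqF r0) (gt_eqF b0) => /negbT rn /negbT bn.
  by move: (r.+1%:R) rn => c rn; field; rewrite rn bn.
rewrite E {1}Ex; move: c0; set c := r.+1%:R * b => c0.
rewrite [in leRHS]exprMn mulrCA ler_pM2l // ler_pM2l ?exprn_gt0 //.
exact: bernoulli_ineq.
Qed.

(** The induction step adds the nonnegative term [p.+1%:R * x ^+ p * (x - s) ^+ 2] to [s] times the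
    previous inequality. The result serves to pass from one moment to the next. *)
Lemma weighted_amgm_pow (R : realFieldType) (s x : R) (p : nat) :
  0 <= s -> 0 <= x ->
  p.+1%:R * s * x ^+ p <= p%:R * x ^+ p.+1 + s ^+ p.+1.
Proof.
move=> s0 x0; elim: p => [|p IHp].
  by rewrite mul1r mul0r add0r expr0 mulr1 expr1.
have h1 : 0 <= p.+1%:R * (x ^+ p * (x - s) ^+ 2).
  apply: mulr_ge0; first exact: ler0n.
  by apply: mulr_ge0; [exact: exprn_ge0 | exact: sqr_ge0].
have h2 := ler_wpM2l s0 IHp.
rewrite -subr_ge0 in h2; rewrite -subr_ge0.
apply: le_trans (addr_ge0 h1 h2) _; rewrite le_eqVlt; apply/orP; left.
apply/eqP; rewrite -!natr1 !exprS; ring.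
Qed.

(** As [q] is odd, [B i ^+ q + |B i| ^+ q] vanishes where [B i] is negative. The nonnegative odd
    moment therefore puts at least half of the absolute moment on the positive entries, where
    [power_above_tangent] raised to the power [q] applies. The gain [2 ^+ q] comes from the
    threshold [beta] being at least [2 * b]. *)
Lemma moment_lower_bound (R : realFieldType) (I : finType) (P : {set I})
    (B F : I -> R) (q r : nat) (b beta s : R) :
  odd q -> 0 < b -> 2 * b <= beta ->
  0 <= \sum_(i in P) B i ^+ q ->
  (forall i, i \in P -> 0 <= F i) ->
  (forall i, i \in P -> r%:R * b + B i <= F i) ->
  s <= #|[set i in P | beta < `|B i|]%SET|%:R ->
  (r.+1%:R * b) ^+ (r.+1 * q) * (2 ^+ q / 2 * s) <=
  \sum_(i in P) F i ^+ (r.+1 * q).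
Proof.
move=> oq b0 bb B0 F0 FB hs.
have bq0 : 0 < b ^+ q by rewrite exprn_gt0.
have rb0 : 0 <= (r.+1%:R * b) ^+ (r.+1 * q).
  by rewrite exprn_ge0 // mulr_ge0 // ltW.
have pt i : i \in P -> (r.+1%:R * b) ^+ (r.+1 * q) *
    ((B i ^+ q + `|B i| ^+ q) / 2) <= b ^+ q * F i ^+ (r.+1 * q).
  move=> iP; case: (lerP 0 (B i)) => Bi.
    rewrite (ger0_norm Bi).
    have -> : (B i ^+ q + B i ^+ q) / 2 = B i ^+ q by field.
    rewrite !exprM -!exprMn; apply: lerXn2r; rewrite ?nnegrE.
    - by rewrite mulr_ge0 // exprn_ge0 // mulr_ge0 // ltW.
    - by rewrite mulr_ge0 ?(ltW b0) // exprn_ge0 // F0.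
    apply: (le_trans (power_above_tangent r b0 Bi)).
    rewrite ler_pM2l //; apply: lerXn2r; rewrite ?nnegrE ?F0 ?FB //.
    by rewrite addr_ge0 // mulr_ge0 // ltW.
  rewrite (ltr0_norm Bi) exprNn -signr_odd oq expr1 mulN1r subrr mul0r mulr0.
  by rewrite mulr_ge0 ?(ltW bq0) // exprn_ge0 // F0.
have beta0 : 0 <= beta by apply: le_trans bb; rewrite mulr_ge0 // ltW.
have large : beta ^+ q * s <= \sum_(i in P) `|B i| ^+ q.
  apply: (@le_trans _ _ (\sum_(i in [set i in P | beta < `|B i|]%SET)
      beta ^+ q)).
    by rewrite sumr_const -[leRHS]mulr_natr ler_wpM2l ?exprn_ge0.
  rewrite [leRHS](bigID (fun i => beta < `|B i|)) /= ler_wpDr //.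
    by apply: sumr_ge0 => i _; rewrite exprn_ge0.
  under eq_bigl => i do rewrite inE.
  by apply: ler_sum => i /andP[_ /ltW Bi]; apply: lerXn2r; rewrite ?nnegrE.
have s0 : (2 * b) ^+ q * s <= \sum_(i in P) `|B i| ^+ q.
  case: (lerP 0 s) => s0.
    apply: le_trans large; rewrite ler_wpM2r //; apply: lerXn2r => //.
    by rewrite nnegrE mulr_ge0 // ltW.
  apply: (@le_trans _ _ 0); last by apply: sumr_ge0 => i _; rewrite exprn_ge0.
  by rewrite mulr_ge0_le0 ?exprn_ge0 ?(ltW s0) // mulr_ge0 // ltW.
rewrite -(ler_pM2l bq0) [leRHS]mulr_sumr.
apply: le_trans (ler_sum _ pt).
rewrite -mulr_sumr mulrCA ler_wpM2l //.
rewrite -mulr_suml big_split /= ler_pdivlMr //.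
rewrite exprMn in s0; lra.
Qed.

(** * Sifting *)

Lemma exists_ge_average (R : realFieldType) (I : finType) (P : pred I)
    (F : I -> R) (c : R) :
  (0 < #|P|)%N -> c * #|P|%:R <= \sum_(i | P i) F i ->
  exists2 i, P i & c <= F i.
Proof.
move=> P_gt0 h; have P0 : 0 < #|P|%:R :> R by rewrite ltr0n.
case/card_gt0P: P_gt0 => i0 Pi0.
case: (Order.TotalTheory.arg_maxP F Pi0) => i Pi imax.
exists i => //; rewrite -(ler_pM2r P0); apply: le_trans h _.
by rewrite mulr_natr -sumr_const; apply: ler_sum.
Qed.

(** Expanding the power over [p]-tuples of [T], coded as functions on ['I_p], separates [x] from
    [x'] in every factor except the weight [h]. *)
Lemma weighted_gram_powE (R : comPzRingType) (X Y : finType) (S : {set X})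
    (T : {set Y}) (g : X -> Y -> R) (h : X -> X -> R) (p : nat) :
  \sum_(x in S) \sum_(x' in S)
    h x x' * (\sum_(y in T) g x y * g x' y) ^+ p =
  \sum_(f : {ffun 'I_p -> Y} | f \in ffun_on (mem T))
    \sum_(x in S) \sum_(x' in S)
      h x x' * ((\prod_j g x (f j)) * \prod_j g x' (f j)).
Proof.
rewrite [RHS]exchange_big; apply: eq_bigr => x _.
rewrite [RHS]exchange_big; apply: eq_bigr => x' _.
rewrite -big_distrr /=; congr (_ * _).
under [RHS]eq_bigr => f _ do rewrite -big_split /=.
rewrite -(bigA_distr_big (mem T) (fun (_ : 'I_p) y => g x y * g x' y)).
by rewrite prodr_const card_ord.
Qed.

(** With weight 1, each tuple of the expansion contributes the square of a sum over [S], whatever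
    the parity of [p]. *)
Lemma sum_gram_pow_ge0 (R : realFieldType) (X Y : finType) (S : {set X})
    (T : {set Y}) (g : X -> Y -> R) (p : nat) :
  0 <= \sum_(x in S) \sum_(x' in S) (\sum_(y in T) g x y * g x' y) ^+ p.
Proof.
have -> : \sum_(x in S) \sum_(x' in S) (\sum_(y in T) g x y * g x' y) ^+ p =
    \sum_(x in S) \sum_(x' in S)
      (fun _ _ => 1) x x' * (\sum_(y in T) g x y * g x' y) ^+ p.
  by apply: eq_bigr => x _; apply: eq_bigr => x' _; rewrite mul1r.
rewrite weighted_gram_powE; apply: sumr_ge0 => f _ /=.
under eq_bigr => x _ do under eq_bigr => x' _ do rewrite /= mul1r.
under eq_bigr => x _ do rewrite -big_distrr /=.
by rewrite -big_distrl /= -expr2 sqr_ge0.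
Qed.

(* The set [S'] is the part of [S] in the common neighbourhood of [p]
   vertices of [T]: for a random choice of these vertices, a pair survives
   with probability proportional to the p-th power of its codegree. *)
Lemma sifting (R : realFieldType) (X Y : finType) (A : X -> Y -> bool)
    (S : {set X}) (T : {set Y}) (h : X -> X -> R) (p : nat) (c : R) :
  (0 < #|T|)%N ->
  c * #|T|%:R ^+ p <= \sum_(x in S) \sum_(x' in S)
    h x x' * (\sum_(y in T) (A x y)%:R * (A x' y)%:R) ^+ p ->
  exists2 S' : {set X}, S' \subset S &
    c <= \sum_(x in S') \sum_(x' in S') h x x'.
Proof.
move=> T_gt0; rewrite weighted_gram_powE.
have cT : #|[pred f : {ffun 'I_p -> Y} | f \in ffun_on (mem T)]| = (#|T| ^ p)%N.
  by rewrite -[in RHS](card_ord p) -card_ffun_on.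
rewrite -natrX -cT => /exists_ge_average; rewrite cT expn_gt0 T_gt0 => -[] //.
move=> f _ /= hf; exists [set x in S | [forall j, A x (f j)]]%SET.
  by apply/fintype.subsetP => x; rewrite inE => /andP[].
apply: le_trans hf _; rewrite le_eqVlt; apply/orP; left; apply/eqP.
have prodE x : \prod_j (A x (f j))%:R = [forall j, A x (f j)]%:R :> R.
  case: (boolP [forall j, A x (f j)]) => [/forallP xf|].
    by rewrite big1 // => j _; rewrite xf.
  rewrite negb_forall => /existsP[j /negbTE xj].
  by rewrite (bigD1 j) //= xj mul0r.
under eq_bigr => x _ do under eq_bigr => x' _ do rewrite !prodE.
rewrite [RHS](eq_bigl (fun x => (x \in S) && [forall j, A x (f j)]));
  last by move=> x; rewrite inE.
rewrite [RHS]big_mkcondr; apply: eq_bigr => x xS.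
case: ifP => xf; last by rewrite big1 // => x' _; rewrite mul0r mulr0.
rewrite [RHS](eq_bigl (fun x => (x \in S) && [forall j, A x (f j)]));
  last by move=> x'; rewrite inE.
rewrite [RHS]big_mkcondr; apply: eq_bigr => x' _.
by case: ifP => _; rewrite ?mulr0 // !mulr1.
Qed.

Definition codegree (R : realFieldType) (X : finType) (A : rel X)
    (T : {set X}) (x x' : X) : R := \sum_(y in T) (A x y)%:R * (A x' y)%:R.

Lemma codegree_ge0 (R : realFieldType) (X : finType) (A : rel X)
    (T : {set X}) (x x' : X) : 0 <= codegree R A T x x'.
Proof. by apply: sumr_ge0 => y _; rewrite mulr_ge0. Qed.

Lemma codegree_le (R : realFieldType) (X : finType) (A : rel X)
    (T : {set X}) (x x' : X) : codegree R A T x x' <= #|T|%:R.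
Proof.
rewrite -sum1_card natr_sum; apply: ler_sum => y _.
by case: (A x y); case: (A x' y); rewrite /= ?mulr1 ?mulr0.
Qed.

Lemma sum_const_pairs (R : pzRingType) (X : finType) (S : {set X}) (c : R) :
  \sum_(x in S) \sum_(x' in S) c = c * #|S|%:R ^+ 2.
Proof. by rewrite !sumr_const expr2 mulrA !mulr_natr. Qed.

(** Sifting is applied with the codegree in excess of [(1 + kappa / 2) * alpha ^+ 2 * #|T|] as
    weight. The resulting [S'] has a large average codegree, hence the degrees from [T] into [S']
    have a large second moment, and many of them must exceed [(1 + delta) * alpha * #|S'|]. *)
Lemma density_increment (R : realFieldType) (X : finType) (A : rel X)
    (alpha kappa delta : R) (S T : {set X}) (p : nat) :
  0 < alpha -> 0 < kappa <= 1 -> 0 <= delta <= kappa / 8 ->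
  (0 < p)%N -> (0 < #|T|)%N ->
  #|X|%:R ^+ 2 * ((1 + kappa) * alpha ^+ 2 * #|T|%:R) ^+ p <=
    \sum_(x in S) \sum_(x' in S) codegree R A T x x' ^+ p ->
  exists S' T' : {set X},
    [/\ kappa / 8 * alpha ^+ p.+1 * #|X|%:R <= #|S'|%:R,
        kappa / 8 * alpha ^+ 2 * #|T|%:R <= #|T'|%:R &
        (1 + delta) * alpha * #|S'|%:R * #|T'|%:R <=
          \sum_(x in S') \sum_(y in T') (A x y)%:R].
Proof.
move=> a0 /andP[k0 k1] /andP[d0 dk] p0 T0.
set t : R := #|T|%:R; set n : R := #|X|%:R; set M := (X in _ <= X) => hM.
have t0 : 0 < t by rewrite ltr0n.
have n0 : 0 < n by rewrite ltr0n (leq_trans T0) // max_card.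
pose s := (1 + kappa) * alpha ^+ 2 * t; rewrite -/s in hM.
have a20 : 0 < alpha ^+ 2 by rewrite exprn_gt0.
have s0 : 0 < s by rewrite !mulr_gt0 // addr_gt0.
pose h x x' : R := codegree R A T x x' - (1 + kappa / 2) * alpha ^+ 2 * t.
pose c := kappa / 2 * alpha ^+ 2 * t * n ^+ 2 * (alpha ^+ 2) ^+ p.
have c0 : 0 < c by rewrite /c !mulr_gt0 ?exprn_gt0 ?invr_gt0.
pose M' : R := \sum_(x in S) \sum_(x' in S) codegree R A T x x' ^+ p.+1.
(* AM-GM at level [s] gives this up to the term [s ^+ p.+1 * #|S| ^+ 2], which the hypothesis on the
   moment [M] bounds by [s * M]. *)
have hM' : s * M <= M'.
  have : \sum_(x in S) \sum_(x' in S) p.+1%:R * s * codegree R A T x x' ^+ p <=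
      \sum_(x in S) \sum_(x' in S)
        (p%:R * codegree R A T x x' ^+ p.+1 + s ^+ p.+1).
    apply: ler_sum => x _; apply: ler_sum => x' _.
    by apply: weighted_amgm_pow; rewrite ?codegree_ge0 // ltW.
  under [leLHS]eq_bigr => x _ do rewrite -mulr_sumr.
  rewrite -mulr_sumr.
  under [leRHS]eq_bigr => x _ do rewrite big_split /= -mulr_sumr.
  rewrite big_split /= -mulr_sumr sum_const_pairs -/M -/M'.
  have hS : s ^+ p.+1 * #|S|%:R ^+ 2 <= s * M.
    rewrite exprS -mulrA ler_wpM2l ?(ltW s0) //; apply: le_trans hM.
    rewrite mulrC ler_wpM2r ?exprn_ge0 ?(ltW s0) //.
    by apply: lerXn2r; rewrite ?nnegrE // ler_nat max_card.
  rewrite -natr1 => hh; have p0' : 0 < p%:R :> R by rewrite ltr0n.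
  by rewrite -(ler_pM2l p0'); lra.
have hsift : c * t ^+ p <= \sum_(x in S) \sum_(x' in S)
    h x x' * (\sum_(y in T) (A x y)%:R * (A x' y)%:R) ^+ p.
  have -> : \sum_(x in S) \sum_(x' in S)
      h x x' * (\sum_(y in T) (A x y)%:R * (A x' y)%:R) ^+ p =
      M' - (1 + kappa / 2) * alpha ^+ 2 * t * M.
    rewrite /M /M' mulr_sumr -sumrB; apply: eq_bigr => x _.
    rewrite mulr_sumr -sumrB; apply: eq_bigr => x' _.
    rewrite /h -/(codegree R A T x x'); move: (codegree R A T x x') => z.
    by rewrite [z ^+ p.+1]exprS; ring.
  have e : s * M = (1 + kappa / 2) * alpha ^+ 2 * t * M
      + kappa / 2 * alpha ^+ 2 * t * M by rewrite /s; field.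
  have e' : c * t ^+ p <= kappa / 2 * alpha ^+ 2 * t * M.
    have -> : c * t ^+ p =
        kappa / 2 * alpha ^+ 2 * t * (n ^+ 2 * (alpha ^+ 2 * t) ^+ p).
      by rewrite /c [in RHS]exprMn; ring.
    rewrite ler_wpM2l //.
      by rewrite !mulr_ge0 ?invr_ge0 // ltW.
    apply: le_trans hM; rewrite ler_wpM2l ?exprn_ge0 //.
    apply: lerXn2r; rewrite ?nnegrE ?(ltW s0) //.
      by rewrite mulr_ge0 ?(ltW a20) ?(ltW t0).
    rewrite /s ler_wpM2r ?(ltW t0) // ler_peMl ?(ltW a20) //.
    by rewrite lerDl ltW.
  lra.
have [S' _ hS'] := sifting T0 hsift.
have hcod : c + (1 + kappa / 2) * alpha ^+ 2 * t * #|S'|%:R ^+ 2 <=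
    \sum_(x in S') \sum_(x' in S') codegree R A T x x'.
  rewrite -lerBrDr -sum_const_pairs -sumrB; apply: le_trans hS' _.
  by apply: ler_sum => x _; rewrite -sumrB.
pose D y : R := \sum_(x in S') (A x y)%:R.
have D_ge0 y : 0 <= D y by apply: sumr_ge0.
have D_le y : D y <= #|S'|%:R.
  by rewrite -sum1_card natr_sum; apply: ler_sum => x _; case: (A x y).
(* Counting by the common neighbour [y] turns the total codegree into a second moment of degrees. *)
have codE : \sum_(x in S') \sum_(x' in S') codegree R A T x x' =
    \sum_(y in T) D y ^+ 2.
  under eq_bigr => x _ do rewrite exchange_big.
  rewrite exchange_big; apply: eq_bigr => y _ /=.
  under eq_bigr => x _ do rewrite -mulr_sumr.
  by rewrite -mulr_suml expr2.
have cod_le : \sum_(x in S') \sum_(x' in S') codegree R A T x x' <=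
    t * #|S'|%:R ^+ 2.
  rewrite -sum_const_pairs; apply: ler_sum => x _; apply: ler_sum => x' _.
  exact: codegree_le.
(* A codegree never exceeds [t], so a total of at least [c] forces [S'] to be large. *)
have S2_ge : c <= t * #|S'|%:R ^+ 2.
  apply: le_trans cod_le; apply: le_trans hcod; rewrite lerDl.
  by rewrite !mulr_ge0 ?exprn_ge0 ?addr_ge0 ?divr_ge0 // ltW.
have S0 : 0 < #|S'|%:R ^+ 2 :> R.
  by rewrite -(pmulr_rgt0 _ t0); apply: lt_le_trans S2_ge.
pose T' := [set y in T | (1 + delta) * alpha * #|S'|%:R <= D y]%SET.
exists S', T'; split.
- have l0 : 0 <= kappa / 8 * alpha ^+ p.+1 * n.
    by rewrite !mulr_ge0 ?exprn_ge0 ?invr_ge0 // ltW.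
  rewrite -ler_sqr ?nnegrE ?l0 // -(ler_pM2l t0); apply: le_trans S2_ge.
  have -> : t * (kappa / 8 * alpha ^+ p.+1 * n) ^+ 2 =
      (kappa / 32) * c.
    have e : (alpha ^+ p.+1) ^+ 2 = alpha ^+ 2 * (alpha ^+ 2) ^+ p.
      by rewrite -(exprM _ p.+1) mulnC (exprM _ 2) exprS.
    rewrite /c exprMn [(kappa / 8 * _) ^+ 2]exprMn e.
    by move: ((alpha ^+ 2) ^+ p) => z; field.
  by rewrite ler_piMl ?(ltW c0) //; lra.
- rewrite -(ler_pM2r S0).
  (* Vertices of [T'] have at most [#|S'|] neighbours in [S'], the others at most
     [(1 + delta) * alpha * #|S'|]. *)
  have hT' : \sum_(y in T) D y ^+ 2 <= #|T'|%:R * #|S'|%:R ^+ 2 +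
      t * ((1 + delta) * alpha * #|S'|%:R) ^+ 2.
    rewrite [leLHS](bigID (mem T')) /=; apply: lerD.
      rewrite mulr_natl -sumr_const [leLHS](eq_bigl (mem T')); last first.
        by move=> y; rewrite /T' /= inE; case: (y \in T).
      by apply: ler_sum => y _; apply: lerXn2r; rewrite ?nnegrE.
    apply: (@le_trans _ _
      (\sum_(y in T) ((1 + delta) * alpha * #|S'|%:R) ^+ 2)).
      rewrite [leRHS](bigID (mem T')) /= ler_wpDl //.
        by apply: sumr_ge0 => y _; rewrite sqr_ge0.
      apply: ler_sum => y /andP[yT]; rewrite inE yT /= -ltNge => /ltW Dy.
      apply: lerXn2r; rewrite ?nnegrE // !mulr_ge0 ?(ltW a0) //.
      by rewrite addr_ge0.
    by rewrite sumr_const -[leLHS]mulr_natl.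
  (* Compared with [1 + kappa / 2], this leaves the margin [kappa / 8] for the size of [T']. *)
  have hd : (1 + delta) ^+ 2 <= 1 + 3 / 8 * kappa by nra.
  have tS : 0 <= t * alpha ^+ 2 * #|S'|%:R ^+ 2.
    by rewrite !mulr_ge0 ?(ltW t0) ?(ltW a0).
  have := ler_wpM2r tS hd.
  have e : t * ((1 + delta) * alpha * #|S'|%:R) ^+ 2 =
    (1 + delta) ^+ 2 * (t * alpha ^+ 2 * #|S'|%:R ^+ 2) by ring.
  rewrite e -codE in hT' => hd'; lra.
- rewrite exchange_big /= mulr_natr -sumr_const; apply: ler_sum => y.
  by rewrite inE => /andP[].
Qed.

(** * Regular sets *)

Definition nbr (X : finType) (A : rel X) (T : {set X}) (x : X) : {set X} :=
  [set y in T | A x y]%SET.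

Definition typical (R : realFieldType) (X : finType) (A : rel X)
    (alpha delta : R) (T : {set X}) (x : X) : bool :=
  `|#|nbr A T x|%:R - alpha * #|T|%:R| <= delta * alpha * #|T|%:R.

Definition few_atypical (R : realFieldType) (X : finType) (A : rel X)
    (alpha delta rho : R) (T : {set X}) : bool :=
  #|[set x | ~~ typical A alpha delta T x]%SET|%:R <= rho * #|X|%:R.

(** The failure of alternative (2) at a threshold [theta], cleared of divisions. *)
Definition no_increment (R : realFieldType) (X : finType) (A : rel X)
    (alpha delta theta : R) : Prop :=
  forall S T : {set X},
    theta * #|X|%:R <= #|S|%:R -> theta * #|X|%:R <= #|T|%:R ->
    \sum_(x in S) \sum_(y in T) (A x y)%:R <
      (1 + delta) * alpha * #|S|%:R * #|T|%:R.

Lemma card_nbrE (R : pzRingType) (X : finType) (A : rel X) (T : {set X})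
    (x : X) : #|nbr A T x|%:R = \sum_(y in T) (A x y)%:R :> R.
Proof.
rewrite -sum1_card natr_sum (eq_bigl (fun y => (y \in T) && A x y)).
  by rewrite big_mkcondr; apply: eq_bigr => y _; case: (A x y).
by move=> y; rewrite inE.
Qed.

Lemma card_nbr_nbrE (R : realFieldType) (X : finType) (A : rel X)
    (T : {set X}) (x x' : X) :
  #|nbr A (nbr A T x) x'|%:R = codegree R A T x x'.
Proof.
rewrite card_nbrE (eq_bigl (fun y => (y \in T) && A x y)).
  rewrite big_mkcondr; apply: eq_bigr => y _.
  by case: (A x y); rewrite ?mul1r ?mul0r.
by move=> y; rewrite inE.
Qed.

(** The Gram matrix of the rows of [A] restricted to [T] and centred at [alpha]. *)
Definition cocorrelation (R : realFieldType) (X : finType) (A : rel X)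
    (alpha : R) (T : {set X}) (x x' : X) : R :=
  \sum_(y in T) ((A x y)%:R - alpha) * ((A x' y)%:R - alpha).

Lemma cocorrelationE (R : realFieldType) (X : finType) (A : rel X)
    (alpha : R) (T : {set X}) (x x' : X) :
  cocorrelation A alpha T x x' =
    codegree R A T x x' - alpha * #|nbr A T x|%:R - alpha * #|nbr A T x'|%:R
    + alpha ^+ 2 * #|T|%:R.
Proof.
have -> : #|T|%:R = \sum_(y in T) 1 :> R by rewrite sumr_const.
rewrite !card_nbrE !mulr_sumr.
rewrite -!sumrB -big_split; apply: eq_bigr => y _ /=; ring.
Qed.

(** Otherwise [moment_lower_bound], with correlations as [B] and codegrees as [F], yields the moment
    hypothesis of [density_increment], whose conclusion contradicts [no_increment]. The condition on
    [2 ^+ q * sigma] makes up for the scarcity of correlated pairs. *)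
Lemma few_correlated_pairs (R : realFieldType) (X : finType) (A : rel X)
    (alpha delta theta c sigma : R) (T : {set X}) (q r : nat) :
  0 < alpha -> (0 < r)%N -> 2 <= c * r%:R ->
  0 <= delta -> delta * 16 * r%:R <= 1 ->
  odd q -> 2 <= 2 ^+ q * sigma -> (0 < #|T|)%N ->
  theta <= (16 * r%:R)^-1 * alpha ^+ (r.+1 * q).+1 ->
  theta * #|X|%:R <= (16 * r%:R)^-1 * alpha ^+ 2 * #|T|%:R ->
  no_increment A alpha delta theta ->
  #|[set p : X * X | [&& typical A alpha delta T p.1,
      typical A alpha delta T p.2 &
      c * alpha ^+ 2 * #|T|%:R < `|cocorrelation A alpha T p.1 p.2|]]%SET|%:R <
    sigma * #|X|%:R ^+ 2.
Proof.
move=> a0 r0 cr d0 dr oq sq T0 th1 th2 noinc; rewrite ltNge; apply/negP => hs.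
pose S := [set x | typical A alpha delta T x]%SET.
set t : R := #|T|%:R in hs th2 *; set n : R := #|X|%:R in hs th1 th2 *.
have t0 : 0 < t by rewrite ltr0n.
have r0' : 0 < r%:R :> R by rewrite ltr0n.
have r1 : 1 <= r%:R :> R by rewrite ler1n.
have a20 : 0 < alpha ^+ 2 by rewrite exprn_gt0.
have a2t : 0 < alpha ^+ 2 * t by rewrite mulr_gt0.
(* For typical [x] and [x'], the codegree is at least the correlation plus
   [(1 - 2 * delta) * alpha ^+ 2 * t]; [b] makes this last term equal to [r%:R * b]. *)
pose b := (1 - 2 * delta) * alpha ^+ 2 * t / r%:R.
have d1 : delta * 16 <= 1 by nra.
have b0 : 0 < b by rewrite /b divr_gt0 // -mulrA mulr_gt0 //; lra.
have rb : r%:R * b = (1 - 2 * delta) * (alpha ^+ 2 * t).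
  by rewrite /b; field; rewrite gt_eqF.
have bc : 2 * b <= c * alpha ^+ 2 * t.
  rewrite -(ler_pM2l r0') mulrCA rb.
  have := ler_wpM2r (ltW a2t) cr.
  have := mulr_ge0 d0 (ltW a2t); lra.
(* Then [r.+1%:R * b] is [(1 - 2 * delta) * (1 + 2 * kappa) * alpha ^+ 2 * t], and the small [delta]
   leaves at least the factor [1 + kappa]. *)
pose kappa : R := (2 * r%:R)^-1.
have k0 : 0 < kappa by rewrite invr_gt0 mulr_gt0.
have rk : r%:R * kappa = 2^-1 by rewrite /kappa; field; rewrite gt_eqF.
have k1 : kappa <= 1 by nra.
have k8 : (16 * r%:R)^-1 = kappa / 8 by rewrite /kappa; field; rewrite gt_eqF.
have dk : delta <= kappa / 8.
  by rewrite -(ler_pM2r r0') mulrAC [kappa * _]mulrC rk; lra.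
have cod_sum p : \sum_(i in finset.setX S S) codegree R A T i.1 i.2 ^+ p =
    \sum_(x in S) \sum_(x' in S) codegree R A T x x' ^+ p.
  by rewrite pair_big; apply: eq_bigl => i; rewrite inE.
have hm := @moment_lower_bound R _ (finset.setX S S)
  (fun i => cocorrelation A alpha T i.1 i.2) (fun i => codegree R A T i.1 i.2)
  q r b (c * alpha ^+ 2 * t) (sigma * n ^+ 2) oq b0 bc.
have [|||||S' [T' [hS' hT' hST]]] := @density_increment R X A alpha kappa delta
  S T (r.+1 * q) a0.
- by rewrite k0.
- by rewrite d0.
- by rewrite muln_gt0 /=; case: (q) oq.
- by [].
- rewrite -cod_sum; apply: le_trans (hm _ _ _ _) => {hm}.
  + rewrite mulrC; apply: ler_pM.
    * by rewrite exprn_ge0 // !mulr_ge0 ?addr_ge0 ?(ltW k0) ?(ltW a0) ?(ltW t0).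
    * by rewrite exprn_ge0.
    * apply: lerXn2r; rewrite ?nnegrE.
      - by rewrite !mulr_ge0 ?addr_ge0 ?(ltW k0) ?(ltW a0) ?(ltW t0).
      - by rewrite mulr_ge0 ?(ltW b0).
      have -> : r.+1%:R * b =
          (1 - 2 * delta) * (1 + 2 * kappa) * (alpha ^+ 2 * t).
        by rewrite -natr1 mulrDl rb /b /kappa mul1r; field; rewrite gt_eqF.
      rewrite -mulrA ler_pM2r //.
      have : delta * kappa <= kappa / 16.
        by rewrite [leRHS]mulrC; apply: ler_wpM2r; rewrite ?(ltW k0) //; lra.
      lra.
    * rewrite mulrA ler_peMl ?exprn_ge0 //; lra.
  + rewrite (_ : \sum_(i in _) _ = \sum_(x in S) \sum_(x' in S)
        cocorrelation A alpha T x x' ^+ q); first exact: sum_gram_pow_ge0.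
    by rewrite pair_big; apply: eq_bigl => i; rewrite inE.
  + by move=> i _; apply: codegree_ge0.
  + move=> [x x']; rewrite !inE /= => /andP[].
    rewrite /typical !ler_norml -/t => /andP[h1 _] /andP[h2 _].
    rewrite rb cocorrelationE -/t.
    have := ler_wpM2l (ltW a0) h1; have := ler_wpM2l (ltW a0) h2; lra.
  + apply: le_trans hs _; rewrite ler_nat; apply: subset_leq_card.
    by apply/fintype.subsetP => i; rewrite !inE -andbA.
have := noinc S' T'; rewrite -/n ltNge hST.
have n0 : 0 <= n by [].
move=> /(_ _ _)/negP; apply=> //.
  by apply: le_trans hS'; rewrite -k8 ler_wpM2r.
by apply: le_trans hT'; rewrite -k8.
Qed.

(** Markov's inequality for the fibres of a relation. *)
Lemma card_heavy_fibres (R : realFieldType) (X Y : finType) (P : X -> Y -> bool)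
    (a : R) :
  #|[set x | a < #|[set y | P x y]%SET|%:R]%SET|%:R * a <=
  #|[set p : X * Y | P p.1 p.2]%SET|%:R.
Proof.
have -> : #|[set p : X * Y | P p.1 p.2]%SET| =
    (\sum_x #|[set y | P x y]%SET|)%N.
  rewrite -sum1_card (eq_bigl (fun p => P p.1 p.2));
    last by move=> p; rewrite inE.
  rewrite -(pair_big_dep xpredT P (fun _ _ => 1%N)).
  apply: eq_bigr => x _ /=; rewrite -sum1_card; apply: eq_bigl => y.
  by rewrite inE.
rewrite natr_sum mulr_natl -sumr_const.
rewrite [leRHS](bigID (mem [set x | a < #|[set y | P x y]%SET|%:R]%SET)) /=.
rewrite ler_wpDr //; first by apply: sumr_ge0.
by apply: ler_sum => x; rewrite inE => /ltW.
Qed.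

(** By [cocorrelationE], the codegree differs from [alpha * #|nbr A T x|] by the correlation plus
    the deviation of the degree of [x'], in all at most [(eta / 4 + delta) * alpha ^+ 2 * #|T|]. The
    allowance is at least [eta * (1 - delta) * alpha ^+ 2 * #|T|]. *)
Lemma typical_nbr (R : realFieldType) (X : finType) (A : rel X)
    (alpha delta eta : R) (T : {set X}) (x x' : X) :
  0 < alpha -> 0 <= eta -> delta <= eta / 4 -> delta <= 2^-1 ->
  typical A alpha delta T x -> typical A alpha delta T x' ->
  `|cocorrelation A alpha T x x'| <= eta / 4 * alpha ^+ 2 * #|T|%:R ->
  typical A alpha eta (nbr A T x) x'.
Proof.
move=> a0 eta0 de d2; rewrite /typical card_nbr_nbrE cocorrelationE.
have t0 : 0 <= #|T|%:R :> R by [].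
rewrite !ler_norml; set t : R := #|T|%:R in t0 *.
set d : R := #|nbr A T x|%:R; set d' : R := #|nbr A T x'|%:R.
set z := codegree _ _ _ _ _ => /andP[h1 _] /andP[h2 h3] /andP[h4 h5].
have a2t : 0 <= alpha ^+ 2 * t by rewrite mulr_ge0 // sqr_ge0.
have h2' := ler_wpM2l (ltW a0) h2; have h3' := ler_wpM2l (ltW a0) h3.
have h1' := ler_wpM2l (mulr_ge0 eta0 (ltW a0)) h1.
have k : (eta / 4 + delta) * (alpha ^+ 2 * t) <=
    (eta - eta * delta) * (alpha ^+ 2 * t).
  apply: ler_wpM2r => //; have := ler_wpM2l eta0 d2; lra.
by apply/andP; split; lra.
Qed.

(** The moment exponent grows linearly with [l], while [M] in [neighbourhood_step] must not depend
    on [l]. These are the two size requirements of [few_correlated_pairs] at threshold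
    [u ^+ (M * l)], in terms of exponents of [u]. *)
Lemma exponent_budget (a b c K l : nat) :
  (0 < l)%N ->
  (a + (c * (2 * (K.+1 * l) + 1)).+1 <=
    (a + 2 + b + c * (2 * K + 3) + K + 1) * l)%N /\
  (a + 2 + b <= (a + 2 + b + c * (2 * K + 3) + K + 1) * l)%N.
Proof.
move=> l0; split.
  have : (c * (2 * (K.+1 * l) + 1) <= c * ((2 * K + 3) * l))%N.
    by rewrite leq_mul2l mulnDl -(mulnA 2) (mulSn K); move: (K * l)%N; lia.
  have := leq_pmulr a l0; rewrite !mulnDl mulnA -!mulnA; lia.
apply: (leq_trans (leq_pmulr _ l0)); rewrite leq_mul2r; lia.
Qed.

(* The integer [l] stands for an upper bound of log (2 / alpha). *)
Lemma neighbourhood_step (R : realType) (eta : R) (K c0 : nat) :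
  0 < eta ->
  exists (delta : R) (M : nat), [/\ 0 < delta, delta <= eta / 4, (K <= M)%N &
  forall (X : finType) (A : rel X) (alpha : R) (l : nat) (T : {set X}),
    0 < alpha <= 1 -> (0 < l)%N -> 1 <= 2 ^+ l * (alpha / 2) ->
    (0 < #|T|)%N -> (alpha / 2) ^+ c0 * #|X|%:R <= #|T|%:R ->
    no_increment A alpha delta ((alpha / 2) ^+ (M * l)) ->
    few_atypical A alpha delta ((alpha / 2) ^+ M) T ->
    #|[set x | ~~ (typical A alpha delta T x &&
        few_atypical A alpha eta ((alpha / 2) ^+ K) (nbr A T x))]%SET|%:R <=
    (alpha / 2) ^+ K * #|X|%:R].
Proof.
move=> eta0; have he : 0 <= 8 / eta by rewrite divr_ge0 // ltW.
(* Large enough for [2 <= c * r%:R] in [few_correlated_pairs] with [c = eta / 4]. *)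
pose r := (Num.bound (8 / eta)).+1.
have hr : 2 <= eta / 4 * r%:R.
  have : 8 / eta <= r%:R.
    by apply: (le_trans (ltW (archi_boundP he))); rewrite ler_nat /r.
  by rewrite ler_pdivrMr //; lra.
have r1 : 1 <= r%:R :> R by rewrite ler1n.
have r0 : 0 < r%:R :> R by lra.
pose delta : R := (16 * r%:R)^-1.
(* As [u] is at most one half, [u ^+ g] lies below the constant [(16 * r%:R)^-1], so constants are
   absorbed into powers of [u]. *)
pose g := (16 * r)%N.
have d0 : 0 < delta by rewrite invr_gt0 mulr_gt0.
have dr : delta * 16 * r%:R = 1 by rewrite /delta; field; rewrite gt_eqF.
have de : delta <= eta / 4.
  by rewrite -(ler_pM2r r0); lra.
have d2 : delta <= 2^-1.
  by rewrite -(ler_pM2r r0); lra.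
pose M := (g + 2 + c0 + r.+1 * (2 * K + 3) + K + 1)%N.
have KM : (K < M)%N by rewrite /M addn1 ltnS leq_addl.
exists delta, M; split => //; first exact: ltnW.
move=> X A alpha l T /andP[a0 a1] l0 lu T0 cT noinc fewT.
set u := alpha / 2 in lu cT noinc fewT *; set n : R := #|X|%:R in cT *.
have u0 : 0 < u by rewrite divr_gt0.
have u2 : u <= 2^-1 by rewrite /u; lra.
have ua : u <= alpha by rewrite /u; lra.
have n0 : 0 <= n by [].
have uexp i j : (i <= j)%N -> u ^+ j <= u ^+ i.
  by move=> ij; apply: ler_wiXn2l => //; [exact: ltW | lra].
have uK1 : 2 * u ^+ K.+1 <= u ^+ K.
  rewrite exprS mulrA -[leRHS]mul1r ler_wpM2r ?exprn_ge0 ?(ltW u0) //; lra.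
have ug : u ^+ g <= delta.
  apply: (@le_trans _ _ (2^-1 ^+ g)).
    by apply: lerXn2r; rewrite ?nnegrE ?(ltW u0).
  rewrite exprVn /delta lef_pV2 ?posrE ?exprn_gt0 ?mulr_gt0 //.
  by rewrite -natrM -natrX ler_nat ltnW // ltn_expl.
(* The factor [2 ^+ q] gained in [moment_lower_bound] outweighs the
   proportion [sigma] of correlated pairs. *)
pose q := (2 * (K.+1 * l) + 1)%N.
have [Mq Mc] := exponent_budget g c0 r.+1 K l0.
pose sigma := u ^+ (2 * K.+1).
have sq : 2 <= 2 ^+ q * sigma.
  have -> : 2 ^+ q * sigma = 2 * ((2 ^+ l * u) ^+ K.+1) ^+ 2.
    rewrite /q /sigma addn1 exprS -mulrA; congr (_ * _).
    rewrite -(exprM _ K.+1) [RHS]exprMn -(exprM _ l).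
    have -> : (l * (K.+1 * 2) = 2 * (K.+1 * l))%N.
      by rewrite mulnA mulnC [(l * _)%N]mulnC mulnA.
    by rewrite (mulnC 2%N K.+1).
  by rewrite ler_peMr // exprn_ege1 // exprn_ege1.
have oq : odd q by rewrite /q addn1 /= mul2n odd_double.
have pairs : #|[set p : X * X | [&& typical A alpha delta T p.1,
    typical A alpha delta T p.2 & eta / 4 * alpha ^+ 2 * #|T|%:R <
      `|cocorrelation A alpha T p.1 p.2|]]%SET|%:R < sigma * n ^+ 2.
  apply: (few_correlated_pairs (q := q) (r := r) a0) noinc => //.
  - exact: ltW.
  - by rewrite dr.
  - apply: (@le_trans _ _ (u ^+ g * u ^+ (r.+1 * q).+1)).
      rewrite -exprD; apply: uexp.
      exact: Mq.
    apply: ler_pM => //; rewrite ?exprn_ge0 ?(ltW u0) //.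
    by apply: lerXn2r; rewrite ?nnegrE ?(ltW u0) ?(ltW a0).
  - apply: (@le_trans _ _ (u ^+ g * u ^+ 2 * (u ^+ c0 * n))).
      rewrite mulrA -!exprD ler_wpM2r //; exact: uexp.
    have ue i : 0 <= u ^+ i by rewrite exprn_ge0 // ltW.
    apply: ler_pM => //; [exact: mulr_ge0 | exact: mulr_ge0 |].
    apply: ler_pM; rewrite ?exprn_ge0 ?(ltW u0) //.
    by apply: lerXn2r; rewrite ?nnegrE ?(ltW u0) ?(ltW a0).
pose P x x' := [&& typical A alpha delta T x, typical A alpha delta T x' &
  eta / 4 * alpha ^+ 2 * #|T|%:R < `|cocorrelation A alpha T x x'|].
(* Since [sigma] is the square of [u ^+ K.+1], Markov's inequality bounds both the threshold and the
   proportion of exceptional [x] by [u ^+ K.+1]; the spare factor [u] pays for the union with the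
   atypical vertices. *)
pose W := [set x | u ^+ K.+1 * n < #|[set x' | P x x']%SET|%:R]%SET.
pose Z := [set x | ~~ typical A alpha delta T x]%SET.
have hZ : #|Z|%:R <= u ^+ K.+1 * n.
  apply: le_trans fewT _; rewrite ler_wpM2r //; exact: uexp.
have nX : 0 < n by rewrite ltr0n (leq_trans T0) // max_card.
have uKn : 0 < u ^+ K.+1 * n by rewrite mulr_gt0 ?exprn_gt0.
have hW : #|W|%:R <= u ^+ K.+1 * n.
  rewrite -(ler_pM2r uKn); apply: le_trans (card_heavy_fibres P _) _.
  apply: (le_trans (ltW pairs)); rewrite /sigma le_eqVlt; apply/orP; left.
  by apply/eqP; rewrite mulnC exprM; ring.
have setU_le (S1 S2 : {set X}) : #|S1|%:R <= u ^+ K.+1 * n ->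
    #|S2|%:R <= u ^+ K.+1 * n -> #|S1 :|: S2|%:R <= u ^+ K * n.
  move=> h1 h2; apply: (@le_trans _ _ (#|S1|%:R + #|S2|%:R)).
    by rewrite -natrD ler_nat cardsU leq_subr.
  have := ler_wpM2r n0 uK1; lra.
apply: le_trans (setU_le _ _ hZ hW); rewrite ler_nat; apply: subset_leq_card.
apply/fintype.subsetP => x; rewrite inE negb_and => /orP[xZ|].
  by rewrite inE; apply/orP; left; rewrite inE.
apply: contraR; rewrite inE negb_or !inE negbK -leNgt => /andP[xT xW].
apply: le_trans (setU_le _ _ hZ xW); rewrite ler_nat; apply: subset_leq_card.
apply/fintype.subsetP => x'; rewrite inE; apply: contraR.
rewrite inE negb_or !inE negbK => /andP[x'T]; rewrite /P xT x'T /= -leNgt.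
by apply: (@typical_nbr _ _ _ _ delta) => //; exact: ltW.
Qed.

(** * Common neighbourhoods of tuples *)

Definition update (k : nat) (X : finType) (x : {ffun 'I_k -> X}) (v : 'I_k)
    (w : X) : {ffun 'I_k -> X} :=
  [ffun i => if i == v then w else x i].

(** Exchanging [w] with the coordinate [x v] is an involution of the pairs [(x, w)]. *)
Lemma sum_resample (R : pzRingType) (k : nat) (X : finType) (v : 'I_k)
    (F : {ffun 'I_k -> X} -> R) :
  \sum_x \sum_w F (update x v w) = #|X|%:R * \sum_x F x.
Proof.
have -> : #|X|%:R * \sum_x F x = \sum_x \sum_(w : X) F x.
  by rewrite mulr_sumr; apply: eq_bigr => x _; rewrite sumr_const mulr_natl.
rewrite !pair_bigA /=.
pose h (p : {ffun 'I_k -> X} * X) := (update p.1 v p.2, p.1 v).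
have hK : involutive h.
  move=> [x w]; rewrite /h /=; congr (_, _); last by rewrite ffunE eqxx.
  by apply/ffunP => i; rewrite !ffunE; case: eqP => [->|].
by rewrite [RHS](reindex_inj (inv_inj hK)).
Qed.

(** Folding from the head lets an induction on [us] replace [T] by the neighbourhood of the first
    vertex in [T]. *)
Definition common_nbr (k : nat) (X : finType) (A : rel X) (T : {set X})
    (x : {ffun 'I_k -> X}) (us : seq 'I_k) : {set X} :=
  foldl (fun T i => nbr A T (x i)) T us.

Lemma eq_common_nbr (k : nat) (X : finType) (A : rel X) (T : {set X})
    (x y : {ffun 'I_k -> X}) (us : seq 'I_k) :
  {in us, x =1 y} -> common_nbr A T x us = common_nbr A T y us.
Proof.
elim: us T => //= v us IH T xy; rewrite /common_nbr /= xy ?mem_head //.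
by apply: IH => i ius; rewrite xy // in_cons ius orbT.
Qed.

Lemma common_nbr_update (k : nat) (X : finType) (A : rel X) (T : {set X})
    (x : {ffun 'I_k -> X}) (us : seq 'I_k) (v : 'I_k) (w : X) :
  v \notin us -> common_nbr A T (update x v w) us = common_nbr A T x us.
Proof.
move=> vus; apply: eq_common_nbr => i ius; rewrite ffunE.
by case: eqP => // iv; rewrite -iv ius in vus.
Qed.

Definition expected_size (R : realFieldType) (k : nat) (X : finType)
    (A : rel X) (alpha eta : R) (T : {set X}) (us : seq 'I_k)
    (x : {ffun 'I_k -> X}) : bool :=
  `|#|common_nbr A T x us|%:R - alpha ^+ size us * #|T|%:R| <=
    eta * alpha ^+ size us * #|T|%:R.

(** The relative errors [eta / 4] and [eta / 2] compose to at most [eta], because [eta <= 1]. *)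
Lemma expected_size_cons (R : realFieldType) (k : nat) (X : finType)
    (A : rel X) (alpha delta eta : R) (T : {set X}) (v : 'I_k)
    (us : seq 'I_k) (x : {ffun 'I_k -> X}) :
  0 < alpha -> 0 <= eta <= 1 -> delta <= eta / 4 ->
  typical A alpha delta T (x v) ->
  expected_size A alpha (eta / 2) (nbr A T (x v)) us x ->
  expected_size A alpha eta T (v :: us) x.
Proof.
move=> a0 /andP[e0 e1] de; rewrite /typical /expected_size.
have -> : common_nbr A T x (v :: us) = common_nbr A (nbr A T (x v)) x us by [].
rewrite [size (v :: us)]/= exprS.
set z : R := #|common_nbr _ _ _ _|%:R; set d : R := #|nbr _ _ _|%:R.
set t : R := #|T|%:R; set P := alpha ^+ size us.
have P0 : 0 <= P by rewrite exprn_ge0 // ltW.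
have Pt : 0 <= P * (alpha * t) by rewrite !mulr_ge0 // ltW.
have dt : delta * (P * (alpha * t)) <= eta / 4 * (P * (alpha * t)).
  exact: ler_wpM2r.
have ee : 0 <= eta * (1 - eta) * (P * (alpha * t)).
  by rewrite mulr_ge0 // mulr_ge0 // subr_ge0.
have ed : eta * (delta * (P * (alpha * t))) <=
    eta * (eta / 4 * (P * (alpha * t))) by exact: ler_wpM2l.
rewrite !ler_norml => /andP[h1 h2] /andP[h3 h4].
have h1' := ler_wpM2l P0 h1; have h2' := ler_wpM2l P0 h2.
have h1e := ler_wpM2l e0 h1'; have h2e := ler_wpM2l e0 h2'.
by apply/andP; split; lra.
Qed.

Lemma no_increment_weaken (R : realFieldType) (X : finType) (A : rel X)
    (alpha delta delta' theta theta' : R) :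
  0 <= alpha -> delta <= delta' -> theta <= theta' ->
  no_increment A alpha delta theta -> no_increment A alpha delta' theta'.
Proof.
move=> a0 dd tt h S T hS hT; apply: lt_le_trans (h S T _ _) _.
- by apply: le_trans hS; rewrite ler_wpM2r.
- by apply: le_trans hT; rewrite ler_wpM2r.
- by rewrite !ler_wpM2r // lerD2l.
Qed.

Lemma few_atypical_weaken (R : realFieldType) (X : finType) (A : rel X)
    (alpha delta delta' rho rho' : R) (T : {set X}) :
  0 <= alpha -> delta <= delta' -> rho <= rho' ->
  few_atypical A alpha delta rho T -> few_atypical A alpha delta' rho' T.
Proof.
move=> a0 dd rr; rewrite /few_atypical => h.
apply: (@le_trans _ _ (rho * #|X|%:R)); last by rewrite ler_wpM2r.
apply: le_trans h; rewrite ler_nat; apply: subset_leq_card.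
apply/fintype.subsetP => x; rewrite !inE; apply: contra => h.
by apply: le_trans h _; rewrite !ler_wpM2r.
Qed.

(** By [neighbourhood_step], all but a proportion [(alpha / 2) ^+ K] of the choices of the first
    vertex leave a regular neighbourhood, to which the induction hypothesis applies. The exceptional
    proportions add up over the vertices. *)
Lemma few_unexpected_sizes (R : realType) (d : nat) (eta : R) (K c0 : nat) :
  0 < eta <= 1 ->
  exists (delta : R) (M : nat), 0 < delta /\
  forall (X : finType) (A : rel X) (alpha : R) (l : nat) (T : {set X})
      (k : nat) (us : seq 'I_k),
    0 < alpha <= 1 -> (0 < l)%N -> 1 <= 2 ^+ l * (alpha / 2) ->
    (0 < #|T|)%N -> (alpha / 2) ^+ c0 * #|X|%:R <= #|T|%:R ->
    no_increment A alpha delta ((alpha / 2) ^+ (M * l)) ->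
    few_atypical A alpha delta ((alpha / 2) ^+ M) T ->
    uniq us -> (size us <= d)%N ->
    \sum_(x : {ffun 'I_k -> X}) (~~ expected_size A alpha eta T us x)%:R <=
      d%:R * (alpha / 2) ^+ K * #|{ffun 'I_k -> X}|%:R.
Proof.
elim: d eta c0 => [|d IHd] eta c0 /andP[e0 e1].
  exists 1, 0%N; split => // X A alpha l T k us _ _ _ _ _ _ _ _.
  rewrite leqn0 size_eq0 => /eqP ->; rewrite !mul0r big1 // => x _.
  by rewrite /expected_size /= expr0 mul1r subrr normr0 mulr1 mulr_ge0 // ltW.
have e2 : 0 < eta / 2 <= 1 by apply/andP; split; lra.
have [delta1 [M1 [d10 H1]]] := IHd (eta / 2) c0.+1 e2.
(* The neighbourhood must be regular enough for the induction hypothesis, hence [delta1]; [eta]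
   serves [expected_size_cons]. *)
have m0 : 0 < Num.min delta1 eta by rewrite lt_min d10.
have [delta [M [d0 d4 KM H]]] := neighbourhood_step (maxn K M1) c0 m0.
have [dd1 de] : delta <= delta1 /\ delta <= eta / 4.
  have : Num.min delta1 eta <= delta1 by rewrite ge_min lexx.
  have : Num.min delta1 eta <= eta by rewrite ge_min lexx orbT.
  split; lra.
exists delta, M; split => // X A alpha l T k us aa l0 lu T0 cT noinc fewT.
have /andP[a0 a1] := aa.
have := H _ _ _ _ _ aa l0 lu T0 cT noinc fewT.
set u := alpha / 2 in lu cT noinc fewT *; set n : R := #|X|%:R in cT *.
set N : R := #|{ffun 'I_k -> X}|%:R.
have u0 : 0 < u by rewrite divr_gt0.
have uexp i j : (i <= j)%N -> u ^+ j <= u ^+ i.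
  by move=> ij; apply: ler_wiXn2l => //; [exact: ltW | rewrite /u; lra].
have uN i : 0 <= u ^+ i * N by rewrite mulr_ge0 // exprn_ge0 // ltW.
have nX : 0 < n by rewrite ltr0n (leq_trans T0) // max_card.
pose G w := typical A alpha delta T w &&
  few_atypical A alpha (Num.min delta1 eta) (u ^+ maxn K M1) (nbr A T w).
rewrite -/G => cardG.
case: us => [|v us]; first move=> _ _.
  rewrite big1 => [|x _]; first by rewrite -mulrA mulr_ge0.
  by rewrite /expected_size /= expr0 mul1r subrr normr0 mulr1 mulr_ge0 // ltW.
rewrite /= ltnS => /andP[vus uus] sus.
pose bad w x : R := (~~ expected_size A alpha (eta / 2) (nbr A T w) us x)%:R.
pose F w x : R := if G w then bad w x else 1.
have F0 w x : 0 <= F w x by rewrite /F; case: ifP.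
apply: (@le_trans _ _ (\sum_(x : {ffun 'I_k -> X}) F (x v) x)).
  apply: ler_sum => x _.
  case: (boolP (expected_size _ _ _ _ (v :: us) x)) => bx; first exact: F0.
  rewrite /F /bad; case: ifP => // /andP[xG _]; rewrite ler_nat lt0b.
  apply: contra bx; apply: (@expected_size_cons _ _ _ _ _ delta) => //.
  by rewrite (ltW e0).
(* As [v] does not occur in [us], [F w x] ignores the coordinate [x v], which may thus be replaced
   by an independent [w]. *)
rewrite -(ler_pM2l nX) -(sum_resample v (fun x => F (x v) x)).
have upE x w : F (update x v w v) (update x v w) = F w x.
  by rewrite /F /bad ffunE eqxx /expected_size common_nbr_update.
under eq_bigr => x _ do under eq_bigr => w _ do rewrite upE.
rewrite exchange_big /=.
have badG w : G w -> \sum_x F w x <= d%:R * u ^+ K * N.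
  move=> Gw; rewrite /F Gw /bad; case/andP: Gw => wT wf.
  (* One neighbourhood costs at most a factor [u] in size, which explains [c0.+1] in the use of the
     induction hypothesis. *)
  have cw : u * #|T|%:R <= #|nbr A T w|%:R.
    move: wT; rewrite /typical ler_norml => /andP[+ _].
    have : delta * (alpha * #|T|%:R) <= 4^-1 * (alpha * #|T|%:R).
      by apply: ler_wpM2r; [rewrite mulr_ge0 // ltW | lra].
    have : 0 <= alpha * #|T|%:R by rewrite mulr_ge0 // ltW.
    rewrite /u; lra.
  apply: (H1 _ _ _ l) => //.
  - by rewrite -(ltr0n R); apply: lt_le_trans cw; rewrite mulr_gt0 ?ltr0n.
  - by apply: le_trans cw; rewrite exprS -mulrA ler_pM2l.
  - apply: no_increment_weaken noinc => //; first exact: ltW.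
    by apply: uexp; rewrite leq_mul2r (leq_trans (leq_maxr K M1)) ?orbT.
  - apply: few_atypical_weaken wf; first exact: ltW.
      by rewrite ge_min lexx.
    by apply: uexp; rewrite leq_maxr.
apply: (@le_trans _ _ (\sum_w (d%:R * u ^+ K * N + (~~ G w)%:R * N))).
  apply: ler_sum => w _; case: (boolP (G w)) => Gw.
    by rewrite mul0r addr0 badG.
  rewrite mul1r /F (negbTE Gw) sumr_const ler_wpDl //.
  by rewrite -mulrA mulr_ge0.
rewrite big_split /= sumr_const -mulr_suml -natr_sum.
have -> : (\sum_w (~~ G w) = #|[set w | ~~ G w]%SET|)%N.
  by rewrite -sum1_card -big_mkcond; apply: eq_bigl => w; rewrite inE.
have cardG' : #|[set w | ~~ G w]%SET|%:R * N <= u ^+ K * n * N.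
  rewrite ler_wpM2r //; apply: le_trans cardG _.
  by rewrite ler_wpM2r // uexp // leq_maxl.
rewrite -natr1 -[_ *+ _]mulr_natl -/n; lra.
Qed.

(** * Removing a vertex of the pattern *)

(** Taking an edge set allows a vertex to be removed by deleting its edges only: it stays in ['I_k]
    as an isolated vertex. *)
Definition hom_sum (R : realFieldType) (k : nat) (X : finType) (A : rel X)
    (E : {set 'I_k * 'I_k}) : R :=
  \sum_(x : {ffun 'I_k -> X}) \prod_(p in E) (A (x p.1) (x p.2))%:R.

Lemma mem_common_nbr (k : nat) (X : finType) (A : rel X) (T : {set X})
    (x : {ffun 'I_k -> X}) (us : seq 'I_k) (w : X) :
  (w \in common_nbr A T x us) = (w \in T) && all (fun i => A (x i) w) us.
Proof.
elim: us T => [|v us IH] T /=; first by rewrite andbT.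
by rewrite /common_nbr /= -/(common_nbr A _ x us) IH inE andbA.
Qed.

Lemma prod_natr_bool (R : comPzSemiRingType) (I : eqType) (s : seq I)
    (P : I -> bool) : \prod_(i <- s) (P i)%:R = (all P s)%:R :> R.
Proof.
elim: s => [|i s IH]; first by rewrite big_nil.
by rewrite big_cons IH /=; case: (P i); rewrite ?mul1r ?mul0r.
Qed.

Definition star (k : nat) (E : {set 'I_k * 'I_k}) (z : 'I_k) :
    {set 'I_k * 'I_k} :=
  [set p in E | (p.1 == z) || (p.2 == z)]%SET.

Definition other_end (k : nat) (z : 'I_k) (p : 'I_k * 'I_k) : 'I_k :=
  if p.1 == z then p.2 else p.1.

Definition star_ends (k : nat) (E : {set 'I_k * 'I_k}) (z : 'I_k) : seq 'I_k :=
  map (other_end z) (enum (star E z)).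

Lemma size_star_ends (k : nat) (E : {set 'I_k * 'I_k}) (z : 'I_k) :
  size (star_ends E z) = #|star E z|.
Proof. by rewrite size_map -cardE. Qed.

(** Edges are oriented upwards, so [z] and a given other end span at most one pair of [E]. *)
Lemma uniq_star_ends (k : nat) (E : {set 'I_k * 'I_k}) (z : 'I_k) :
  (forall p, p \in E -> (p.1 < p.2)%N) -> uniq (star_ends E z).
Proof.
move=> E_simple; rewrite map_inj_in_uniq ?enum_uniq // => -[a b] [c d].
rewrite !mem_enum !inE /= => /andP[/E_simple/= ab +] /andP[/E_simple/= cd +].
rewrite /other_end /=; case: (a =P z) => [az|_] /=; case: (c =P z) => [cz|_] /=.
- by move=> _ _ bd; rewrite az cz bd.
- move=> _ /eqP dz bc; rewrite az bc in ab; rewrite dz in cd.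
  by have := ltn_trans ab cd; rewrite ltnn.
- move=> /eqP bz _ ad; rewrite bz in ab; rewrite cz -ad in cd.
  by have := ltn_trans ab cd; rewrite ltnn.
- by move=> /eqP bz /eqP dz ac; rewrite bz dz ac.
Qed.

Lemma card_star_setD (k : nat) (E : {set 'I_k * 'I_k}) (z : 'I_k) :
  (#|star E z| + #|E :\: star E z|)%N = #|E|.
Proof.
rewrite -(cardsID (star E z) E) (finset.setIidPr _) //.
by apply/fintype.subsetP => p; rewrite inE => /andP[].
Qed.

(** Resample the image of [z] as [w]: edges outside the star do not see [w], and those of the star
    say that [w] is a common neighbour. *)
Lemma hom_sum_star (R : realFieldType) (k : nat) (X : finType)
    (A : rel X) (E : {set 'I_k * 'I_k}) (z : 'I_k) :
  (forall p, p \in E -> (p.1 < p.2)%N) -> symmetric A ->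
  #|X|%:R * hom_sum R A E =
  \sum_(x : {ffun 'I_k -> X})
    (\prod_(p in E :\: star E z) (A (x p.1) (x p.2))%:R) *
    #|common_nbr A [set: X]%SET x (star_ends E z)|%:R.
Proof.
move=> E_simple Asym; rewrite -(sum_resample z); apply: eq_bigr => x _.
rewrite -sum1_card natr_sum mulr_sumr [RHS]big_mkcond; apply: eq_bigr => w _.
rewrite (bigID (mem (star E z))) /= mulrC mem_common_nbr !inE /=.
have -> : \prod_(p in E | p \notin star E z)
    (A (update x z w p.1) (update x z w p.2))%:R =
    \prod_(p in E :\: star E z) (A (x p.1) (x p.2))%:R :> R.
  apply: eq_big => [p|p /andP[pE]]; first by rewrite !inE andbC.
  rewrite inE pE /= negb_or => /andP[p1 p2].
  by rewrite !ffunE (negbTE p1) (negbTE p2).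
have -> : \prod_(p in E | p \in star E z)
    (A (update x z w p.1) (update x z w p.2))%:R =
    (all (fun i => A (x i) w) (star_ends E z))%:R :> R.
  rewrite -prod_natr_bool big_map big_enum /=.
  apply: eq_big => [p|p /andP[pE]]; first by rewrite inE andbA andbb.
  rewrite inE pE /= /other_end !ffunE; have := E_simple _ pE.
  case: eqP => [->|_] /= pp; last by move=> /eqP ->; rewrite eqxx.
  by rewrite -(val_eqE p.2) /= gtn_eqF // Asym.
by case: (all _ _); rewrite ?mulr1 ?mulr0.
Qed.

(** In [hom_sum_star], the common neighbourhood has the expected size for most tuples. Each
    exceptional tuple costs at most [#|X|], since the product over the remaining edges is at most
    1. *)
Lemma vertex_removal (R : realFieldType) (k : nat) (X : finType) (A : rel X)
    (E : {set 'I_k * 'I_k}) (z : 'I_k) (alpha eta rho : R) :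
  (forall p, p \in E -> (p.1 < p.2)%N) -> symmetric A -> (0 < #|X|)%N ->
  0 <= alpha <= 1 -> 0 <= eta ->
  \sum_(x : {ffun 'I_k -> X})
    (~~ expected_size A alpha eta [set: X]%SET (star_ends E z) x)%:R <= rho ->
  `|hom_sum R A E - alpha ^+ #|star E z| * hom_sum R A (E :\: star E z)| <=
    eta * alpha ^+ #|star E z| * hom_sum R A (E :\: star E z) + rho.
Proof.
move=> Es Asym X0 /andP[a0 a1] e0 hrho.
set us := star_ends E z in hrho *; set E' := E :\: _; set Q := alpha ^+ _.
have n0 : 0 < #|X|%:R :> R by rewrite ltr0n.
pose W (x : {ffun 'I_k -> X}) : R := \prod_(p in E') (A (x p.1) (x p.2))%:R.
have W0 (x : {ffun 'I_k -> X}) : 0 <= W x by apply: prodr_ge0.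
have W1 (x : {ffun 'I_k -> X}) : W x <= 1.
  by apply: prodr_ile1 => p _; rewrite ler0n lern1 leq_b1.
rewrite -(ler_pM2l n0) -{1}(ger0_norm (ltW n0)) -normrM mulrBr.
rewrite (hom_sum_star _ z) // -/E' -/us mulrDr.
have -> : #|X|%:R * (Q * hom_sum R A E') = \sum_x W x * (Q * #|X|%:R).
  by rewrite -mulr_suml /W /hom_sum; ring.
have -> : #|X|%:R * (eta * Q * hom_sum R A E') =
    \sum_x W x * (eta * Q * #|X|%:R).
  by rewrite -mulr_suml /W /hom_sum; ring.
rewrite -sumrB; apply: le_trans (ler_norm_sum _ _ _) _.
apply: le_trans (_ : _ <= \sum_(x : {ffun 'I_k -> X})
  (W x * (eta * Q * #|X|%:R) +
   #|X|%:R * (~~ expected_size A alpha eta [set: X]%SET us x)%:R)) _; last first.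
  by rewrite big_split /= lerD2l -mulr_sumr ler_wpM2l // ltW.
apply: ler_sum => x _; rewrite -mulrBr normrM (ger0_norm (W0 x)).
have Q01 : 0 <= Q <= 1 by rewrite exprn_ge0 // exprn_ile1.
case: (boolP (expected_size _ _ _ _ _ _)) => [|_].
  rewrite /expected_size size_star_ends cardsT mulr0 addr0 -/Q => h.
  by rewrite ler_wpM2l.
have C0 : 0 <= #|common_nbr A [set: X]%SET x us|%:R :> R by [].
have C1 : #|common_nbr A [set: X]%SET x us|%:R <= #|X|%:R :> R.
  by rewrite ler_nat max_card.
have /andP[Q0 Q1] := Q01.
have Qn0 : 0 <= Q * #|X|%:R by rewrite mulr_ge0.
have Qn1 : Q * #|X|%:R <= #|X|%:R by rewrite ler_piMl.
rewrite mulr1 ler_wpDl //.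
  by rewrite mulr_ge0 // -mulrA mulr_ge0.
apply: le_trans (ler_piMl _ (W1 x)) _; rewrite ?normr_ge0 //.
by rewrite ler_norml; apply/andP; split; lra.
Qed.

(** Induction on the number of edges, deleting one nonempty star at a time. Since the accumulated
    relative error stays at most 1, the smaller count is at most twice its main term, so a deletion
    adds at most [3 * eta]: twice [eta] from the typical tuples, once from the exceptional ones. *)
Lemma hom_sum_estimate (R : realFieldType) (k : nat) (X : finType) (A : rel X)
    (m : nat) (alpha eta : R) :
  symmetric A -> (0 < #|X|)%N -> 0 < alpha <= 1 -> 0 <= eta ->
  3 * eta * m%:R <= 1 ->
  (forall us : seq 'I_k, uniq us -> (size us <= m)%N ->
    \sum_(x : {ffun 'I_k -> X})
      (~~ expected_size A alpha eta [set: X]%SET us x)%:R <=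
    eta * alpha ^+ m * #|{ffun 'I_k -> X}|%:R) ->
  forall E : {set 'I_k * 'I_k},
    (forall p, p \in E -> (p.1 < p.2)%N) -> (#|E| <= m)%N ->
    `|hom_sum R A E - alpha ^+ #|E| * #|{ffun 'I_k -> X}|%:R| <=
      3 * eta * #|E|%:R * alpha ^+ #|E| * #|{ffun 'I_k -> X}|%:R.
Proof.
move=> Asym X0 /andP[a0 a1] e0 e3 hus E.
set N : R := #|{ffun 'I_k -> X}|%:R in hus *; have N0 : 0 <= N by [].
have [j] := ubnP #|E|; elim: j E => // j IH E; rewrite ltnS => Ej Es Em.
case: (set_0Vmem E) => [->|[p pE]].
  rewrite cards0 expr0 mul1r mulr0 !mul0r /hom_sum.
  under eq_bigr => x _ do rewrite big_set0.
  by rewrite sumr_const subrr normr0.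
pose z := p.1; have := card_star_setD E z.
have star0 : (0 < #|star E z|)%N.
  by apply/card_gt0P; exists p; rewrite inE pE /z eqxx.
have := @vertex_removal R k X A E z alpha eta (eta * alpha ^+ m * N) Es Asym X0.
rewrite (ltW a0) a1 => /(_ isT e0) hv hc.
have {hv} := hv (hus _ (uniq_star_ends z Es) _); rewrite size_star_ends.
have sm : (#|star E z| <= m)%N by rewrite (leq_trans _ Em) // -hc leq_addr.
move=> /(_ sm); set Q := alpha ^+ #|star E z|.
have := IH (E :\: star E z).
set E' := E :\: _ in hc *; set h' := hom_sum R A E' => IHE.
have {IHE} := IHE _ _ _.
have E'E : (#|E'| < #|E|)%N by rewrite -hc -[ltnLHS]add0n ltn_add2r.
move=> /(_ (leq_trans E'E Ej)) IHE.
have {IHE} := IHE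
  (fun p pE' => Es p (fintype.subsetP (finset.subsetDl _ _) p pE')).
move=> /(_ (leq_trans (ltnW E'E) Em)).
have -> : alpha ^+ #|E| = Q * alpha ^+ #|E'| by rewrite -exprD hc.
set P := alpha ^+ #|E'|; set h := hom_sum R A E.
have Q0 : 0 <= Q by rewrite exprn_ge0 // ltW.
have P0 : 0 <= P by rewrite exprn_ge0 // ltW.
(* This makes the exceptional tuples a relative error, as [E] has at most [m] edges. *)
have mQP : alpha ^+ m <= Q * P.
  by rewrite -exprD hc; apply: ler_wiXn2l => //; exact: ltW.
have mQPN : eta * alpha ^+ m * N <= eta * (Q * P) * N.
  by rewrite ler_wpM2r // ler_wpM2l.
have e'1 : 3 * eta * #|E'|%:R <= 1.
  apply: le_trans e3; rewrite ler_wpM2l ?mulr_ge0 // ler_nat.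
  exact: leq_trans (ltnW E'E) Em.
have eE : 3 * eta * (#|E'|%:R + 1) <= 3 * eta * #|E|%:R.
  by rewrite ler_wpM2l ?mulr_ge0 // natr1 ler_nat.
move: e'1 eE; set e' := 3 * eta * #|E'|%:R; set e := 3 * eta * #|E|%:R.
rewrite mulrDr -/e' mulr1 => e'1 eE.
have PN0 : 0 <= P * N by rewrite mulr_ge0.
have QPN0 : 0 <= Q * (P * N) by rewrite mulr_ge0.
rewrite !ler_norml => /andP[h1 h2] /andP[h3 h4].
have h1Q := ler_wpM2l Q0 h1; have h2Q := ler_wpM2l Q0 h2.
have h2eQ := ler_wpM2l e0 h2Q.
have k1 := ler_wpM2r QPN0 eE.
have k2 : eta * (e' * (Q * (P * N))) <= eta * (Q * (P * N)).
  by rewrite ler_wpM2l // ler_piMl.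
by apply/andP; split; lra.
Qed.

(** * The counting lemma *)

(** Translates the thresholds of the theorem into powers of [alpha / 2], the scale of all the
    preceding bounds. *)
Lemma powR_neg_log2 (R : realType) (alpha : R) (M : nat) :
  0 < alpha -> 2 `^ (- (M%:R * log2 (2 / alpha))) = (alpha / 2) ^+ M.
Proof.
move=> a0; have ln20 : ln 2 != 0 :> R by rewrite gt_eqF // ln_gt0 // ltr1n.
have -> : - (M%:R * log2 (2 / alpha)) = - log2 (2 / alpha) * M%:R by ring.
rewrite powRrM powR_mulrn ?powR_ge0 //; congr (_ ^+ _).
rewrite powRN /powR pnatr_eq0 /= /log2 divfK // lnK ?posrE ?divr_gt0 //.
by rewrite invf_div.
Qed.

Lemma log2_ge1 (R : realType) (alpha : R) :
  0 < alpha <= 1 -> 1 <= log2 (2 / alpha).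
Proof.
move=> /andP[a0 a1]; have ln20 : 0 < ln 2 :> R by rewrite ln_gt0 // ltr1n.
rewrite /log2 ler_pdivlMr // mul1r ler_ln ?posrE ?divr_gt0 //.
by rewrite ler_pdivlMr // ler_piMr.
Qed.

Lemma density_onE (R : realType) (X : finType) (A : rel X) (S T : {set X}) :
  density_on R A S T =
  (\sum_(x in S) \sum_(y in T) (A x y)%:R) / (#|S|%:R * #|T|%:R).
Proof.
rewrite /density_on /expect cardsX natrM pair_big; congr (_ / _).
by apply: eq_bigl => p; rewrite inE.
Qed.

Lemma hom_densityE (R : realType) (k : nat) (H : rel 'I_k) (X : finType)
    (A : rel X) :
  hom_density R H A = hom_sum R A (edges H) / #|{ffun 'I_k -> X}|%:R.
Proof.
rewrite /hom_density /expect cardsT; congr (_ / _).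
by apply: eq_bigl => x; rewrite inE.
Qed.

Lemma density_le1 (R : realType) (X : finType) (A : rel X) : density R A <= 1.
Proof.
rewrite /density density_onE; case: (posnP #|X|) => X0.
  by rewrite cardsT X0 mul0r invr0 mulr0.
rewrite ler_pdivrMr ?mul1r; last by rewrite cardsT mulr_gt0 ?ltr0n.
apply: (@le_trans _ _ (\sum_(x in [set: X]%SET) \sum_(y in [set: X]%SET) 1)).
  by apply: ler_sum => x _; apply: ler_sum => y _; rewrite lern1 leq_b1.
by rewrite sum_const_pairs mul1r expr2.
Qed.

(** If the vertices of high degree were more than a proportion [rho], they would form a density
    increment against the whole vertex set. *)
Lemma few_atypical_setT (R : realFieldType) (X : finType) (A : rel X)
    (alpha delta rho : R) :
  (0 < #|X|)%N -> 0 <= rho <= 1 -> no_increment A alpha delta rho ->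
  #|[set x : X | ((degree A x)%:R <=
      (1 - delta) * alpha * #|X|%:R :> R)%R]%SET|%:R <= rho * #|X|%:R ->
  few_atypical A alpha delta (2 * rho) [set: X]%SET.
Proof.
move=> X0 /andP[r0 r1] noinc; set low := [set x | _]%SET => hlow.
set n : R := #|X|%:R in hlow *.
have n0 : 0 < n by rewrite ltr0n.
have degE x : nbr A [set: X]%SET x = [set y | A x y]%SET.
  by apply/setP => y; rewrite !inE.
pose high := [set x : X | (1 + delta) * alpha * n <= (degree A x)%:R]%SET.
have hhigh : #|high|%:R <= rho * n.
  rewrite leNgt; apply/negP => /ltW hh.
  have := noinc high [set: X]%SET hh; rewrite cardsT -/n ler_piMl ?(ltW n0) //.
  move=> /(_ isT); apply/negP.
  rewrite -leNgt -mulrA [#|high|%:R * n]mulrC mulrA.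
  rewrite mulr_natr -sumr_const; apply: ler_sum => x.
  by rewrite inE -card_nbrE degE.
rewrite /few_atypical -/n.
apply: (@le_trans _ _ (#|low|%:R + #|high|%:R)); last by lra.
rewrite -natrD ler_nat; apply: leq_trans (leq_card_setU low high).
apply: subset_leq_card; apply/fintype.subsetP => x; rewrite !inE /typical.
rewrite degE cardsT -/n -/(degree A x) ler_norml negb_and -!ltNge.
by case/orP => /ltW h; apply/orP; [left|right]; lra.
Qed.

Theorem theorem1p4 (R : realType) (m : nat) (eps : R) (m_gt0 : (0 < m)%N)
    (eps_gt0 : 0 < eps) (eps_lt1 : eps < 1) :
  exists delta C : R, 0 < delta /\ 0 < C /\
  forall (k : nat) (H : rel 'I_k), symmetric H -> irreflexive H ->
    #|edges H| = m ->
  forall (X : finType) (A : rel X) (alpha : R), symmetric A ->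
    density R A = alpha -> 0 < alpha ->
    `| hom_density R H A - alpha ^+ m | >= eps * alpha ^+ m ->
    (#|[set x : X | ((degree A x)%:R <= (1 - delta) * alpha * #|X|%:R :> R)%R]%SET|%:R
       >= 2 `^ (- (C * log2 (2 / alpha))) * #|X|%:R :> R)
    \/
    (exists S T : {set X},
       [/\ #|S|%:R / #|X|%:R >= 2 `^ (- (C * log2 (2 / alpha) ^+ 2)) :> R,
           #|T|%:R / #|X|%:R >= 2 `^ (- (C * log2 (2 / alpha) ^+ 2)) :> R &
           density_on R A S T >= (1 + delta) * alpha]).
Proof.
have m1 : 1 <= m%:R :> R by rewrite ler1n.
have m0 : 0 < m%:R :> R by rewrite ltr0n.
(* The final relative error [3 * eta * m%:R] is then three quarters of [eps]. *)
pose eta : R := eps / (4 * m%:R).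
have eta0 : 0 < eta by rewrite divr_gt0 // mulr_gt0.
have em : eta * m%:R = eps / 4 by rewrite /eta; field; rewrite gt_eqF.
have e3 : 3 * eta * m%:R <= 1 by rewrite -mulrA em; lra.
have e34 : 3 * (eps / 4) < eps by lra.
have eta1 : 0 < eta <= 1.
  by rewrite eta0 /=; have := ler_wpM2l (ltW eta0) m1; lra.
(* Then [m%:R * u ^+ (m + g)] is at most [eta * alpha ^+ m], because [u] is at most one half and at
   most [alpha]. *)
pose g := Num.bound (m%:R / eta).
have hg : m%:R <= eta * 2 ^+ g.
  rewrite mulrC -ler_pdivrMr //.
  apply: (le_trans (ltW (archi_boundP _))); first by rewrite divr_ge0 // ltW.
  by rewrite -natrX ler_nat ltnW // ltn_expl.
have [delta [M [d0 HM]]] := few_unexpected_sizes m (m + g)%N 0 eta1.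
(* With this choice [C * L] dominates both [M.+1] and [M * l], as [L >= 1] and [l <= 2 * L]. *)
pose C : R := (2 * M + 2)%:R.
exists delta, C; split => //; split; first by rewrite ltr0n addn2.
move=> k H Hsym Hirr Hm X A alpha Asym dens a0 far.
have a1 : alpha <= 1 by rewrite -dens density_le1.
have X0 : (0 < #|X|)%N.
  rewrite lt0n; apply/eqP => X0; move: a0.
  by rewrite -dens /density density_onE cardsT X0 mul0r invr0 mulr0 ltxx.
set n : R := #|X|%:R; have n0 : 0 < n by rewrite ltr0n.
set L := log2 (2 / alpha).
have L1 : 1 <= L by apply: log2_ge1; rewrite a0.
set u := alpha / 2; set theta := 2 `^ (- (C * L ^+ 2)).
have u0 : 0 < u by rewrite divr_gt0.
have u2 : u <= 2^-1 by rewrite /u; lra.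
have ua : u <= alpha by rewrite /u; lra.
have thetau i : i%:R <= C * L -> theta <= u ^+ i.
  move=> iC; rewrite /theta -powR_neg_log2 // -/L ler_powR ?ler1n // lerN2.
  by rewrite expr2 mulrA ler_wpM2r //; lra.
case: (boolP (2 `^ (- (C * L)) * n <= _)) => low; first by left.
right; apply: contrapT => noST; move: far; apply/negP; rewrite -ltNge.
have noinc : no_increment A alpha delta theta.
  move=> S T hS hT; rewrite ltNge; apply/negP => hST; apply: noST.
  have th0 : 0 < theta by apply: powR_gt0.
  have S0 : 0 < #|S|%:R :> R by apply: lt_le_trans hS; rewrite mulr_gt0.
  have T0 : 0 < #|T|%:R :> R by apply: lt_le_trans hT; rewrite mulr_gt0.
  exists S, T; split; [by rewrite ler_pdivlMr | by rewrite ler_pdivlMr |].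
  by rewrite density_onE ler_pdivlMr ?mulr_gt0 // mulrA.
have uexp i j : (i <= j)%N -> u ^+ j <= u ^+ i.
  by move=> ij; apply: ler_wiXn2l => //; [exact: ltW | rewrite /u; lra].
have CL0 : 0 <= M%:R * (L - 1) by rewrite mulr_ge0 // subr_ge0.
(* The exponent [M.+1] compensates for the factor 2 in [few_atypical_setT]. *)
have few : few_atypical A alpha delta (u ^+ M) [set: X]%SET.
  apply: (@few_atypical_weaken _ _ _ _ delta _ (2 * u ^+ M.+1)) => //.
  - exact: ltW.
  - rewrite exprS mulrA ler_piMl ?exprn_ge0 ?(ltW u0) //; rewrite /u; lra.
  - apply: few_atypical_setT => //.
    + by rewrite exprn_ge0 ?(ltW u0) //= exprn_ile1 ?(ltW u0) // /u; lra.
    + apply: no_increment_weaken noinc => //; first exact: ltW.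
      apply: thetau; rewrite /C natrD natrM -[M.+1%:R]natr1.
      by have := ler0n R M; lra.
    + move: low; rewrite -ltNge => /ltW /le_trans; apply.
      rewrite ler_wpM2r ?(ltW n0) // powR_neg_log2 //; apply: uexp.
      by rewrite addn2 ltnS mul2n -addnn leqW // leq_addr.
(* This integer lies between [L] and [2 * L]. As [u] is 2 to the power [- L], the threshold
   [u ^+ (M * l)] is the source of the squared logarithm in alternative (2). *)
pose l := (Num.truncn L).+1.
have lL : l%:R <= 2 * L.
  have : (Num.truncn L)%:R <= L by rewrite truncn_le; lra.
  by rewrite /l -natr1; lra.
have lu : 1 <= 2 ^+ l * u.
  have -> : u = 2 `^ (- L).
    by rewrite -[u]expr1 -powR_neg_log2 // mul1r.
  rewrite -powR_mulrn // -powRD ?pnatr_eq0 ?implybT //.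
  rewrite -[leLHS](powRr0 2) ler_powR ?ler1n // subr_ge0 ltW //.
  exact: truncnS_gt.
have sums := HM X A alpha l [set: X]%SET k.
have {sums} sums us : uniq us -> (size us <= m)%N ->
    \sum_(x : {ffun 'I_k -> X})
      (~~ expected_size A alpha eta [set: X]%SET us x)%:R <=
    eta * alpha ^+ m * #|{ffun 'I_k -> X}|%:R.
  move=> uus sus; apply: (le_trans (sums us _ _ lu _ _ _ few uus sus)) => //.
  - by rewrite a0.
  - by rewrite cardsT.
  - by rewrite cardsT expr0 mul1r.
  - apply: no_increment_weaken noinc => //; first exact: ltW.
    apply: thetau; rewrite /C natrM natrD natrM.
    apply: (le_trans (ler_wpM2l (ler0n R M) lL)).
    by rewrite mulrCA mulrA ler_wpM2r ?lerDl // (le_trans ler01).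
  rewrite ler_wpM2r // exprD mulrA mulrAC.
  apply: ler_pM; rewrite ?mulr_ge0 ?exprn_ge0 ?(ltW u0) //.
    apply: le_trans (_ : eta * 2 ^+ g * u ^+ g <= _).
      by rewrite ler_wpM2r // exprn_ge0 // ltW.
    rewrite -mulrA -exprMn ler_piMr ?(ltW eta0) // exprn_ile1 //.
      by rewrite mulr_ge0 // ltW.
    by rewrite -ler_pdivlMl // mulr1.
  by apply: lerXn2r; rewrite ?nnegrE ?(ltW u0) ?(ltW a0).
have Es p : p \in edges H -> (p.1 < p.2)%N by rewrite inE => /andP[].
have aa : 0 < alpha <= 1 by rewrite a0.
have := hom_sum_estimate Asym X0 aa (ltW eta0) e3 sums Es.
rewrite Hm leqnn => /(_ isT); rewrite -[3 * eta * _]mulrA em hom_densityE.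
set N : R := #|{ffun 'I_k -> X}|%:R => est.
have N0 : 0 < N by rewrite ltr0n card_ffun expn_gt0 X0.
rewrite -(ltr_pM2r N0) -[X in _ * X < _](gtr0_norm N0) -normrM mulrBl.
rewrite divfK ?gt_eqF //.
apply: (le_lt_trans est); rewrite ltr_pM2r // ltr_pM2r ?exprn_gt0 //.
Qed.
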